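(* Let $G$ be a finite solvable group, let $\gamma$ be a positive integer, and let $H$ be a maximal intersection in $G$. If every $V\in\mathcal V_H$ is a $\gamma$-module, then $H$ is a $(\gamma+1)$-intersection in $G$, i.e. there exists a family of maximal subgroups $M_1,\dots,M_t$ of $G$ such that $H=M_1\cap\dots\cap M_t$ and $|G:M_1|\cdots|G:M_t|\le |G:H|^{\gamma+1}$.
   Context: A maximal intersection in a finite group $G$ is a subgroup of $G$ that can be expressed as an intersection of maximal subgroups of $G$. For a maximal subgroup $M$ of $G$, let $Y_M=\bigcap_{g\in G}M^g$ be the normal core of $M$ in $G$ and let $X_M/Y_M$ be the socle of the primitive permutation group $G/Y_M$ (acting on the right cosets of $M/Y_M$); for $G$ solvable, $X_M/Y_M$ is a chief factor of $G$, regarded as an irreducible $G$-module by conjugation. For a maximal intersection $H$ in $G$, $\mathcal V_H$ denotes the set of irreducible $G$-modules that are $G$-isomorphic to $X_M/Y_M$ for some maximal subgroup $M$ of $G$ containing $H$. Let $V$ be an irreducible $G$-module and $F=\operatorname{End}_G(V)$. $V$ is called a $\gamma$-module if for every $F$-subspace $W$ of $V$ there exists an $F$-subspace $W^*$ of $V$ such that (1) $\dim_F(W^* )\le\gamma$, and (2) $C_G(W)=C_G(W^* )\cap\bigl(\bigcap_{M\in\mathcal M_W}M\bigr)$, where $\mathcal M_W$ is the set of maximal subgroups of $G$ containing $C_G(W)$ (an empty intersection being $G$). *)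

(* Defs.v *)
From mathcomp Require Import all_boot all_order all_algebra.
From mathcomp Require Import all_fingroup all_solvable.

Set Implicit Arguments.
Unset Strict Implicit.
Unset Printing Implicit Defensive.

Import GroupScope GRing.Theory.

Section MaximalIntersections.

Variables (gT : finGroupType) (G : {group gT}).

(* The leading G :&: makes the intersection of the empty family equal to G. *)
Definition inter_of_maximals (t : nat) (M : 'I_t -> {group gT})
    (H : {group gT}) : Prop :=
  (forall i, maximal (M i) G) /\ H :=: G :&: \bigcap_(i < t) M i.

Definition maximal_intersection (H : {group gT}) : Prop :=
  exists (t : nat) (M : 'I_t -> {group gT}), inter_of_maximals M H.

Definition k_intersection (k : nat) (H : {group gT}) : Prop :=
  exists (t : nat) (M : 'I_t -> {group gT}),
    inter_of_maximals M H
    /\ (\prod_(i < t) #|G : M i| <= #|G : H| ^ k)%N.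

End MaximalIntersections.

(* minnormal N K only requires that K normalises N, hence the extra
   condition N \subset K. *)
Definition socle (gT : finGroupType) (K : {set gT}) : {set gT} :=
  <<\bigcup_(N : {group gT} | minnormal N K && (N \subset K)) N>>.

(* Irreducible modules are only needed up to isomorphism with chief factors of
   G, so the carrier is taken finite. The action of G is on the right. *)
Record irrModule (gT : finGroupType) (G : {group gT}) := IrrModule {
  irr_sort :> finZmodType;
  irr_act : groupAction G [set: irr_sort];
  irr_act_irreducible : acts_irreducibly G [set: irr_sort] irr_act }.

Section IrreducibleModules.

Variables (gT : finGroupType) (G : {group gT}) (V : irrModule G).

Local Notation to := (irr_act V).

(* The elements of F = End_G(V). *)
Record gEnd := GEnd {
  gEnd_fun :> {additive V -> V};
  gEnd_equivariant : forall g v, g \in G -> gEnd_fun (to v g) = to (gEnd_fun v) g }.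

Definition Fsubspace (W : {set V}) : Prop :=
  [/\ (0%R : V) \in W,
      forall u v : V, u \in W -> v \in W -> (u + v)%R \in W
    & forall (a : gEnd) (v : V), v \in W -> a v \in W].

Definition Fcomb (n : nat) (a : 'I_n -> gEnd) (w : 'I_n -> V) : V :=
  (\sum_(i < n) a i (w i))%R.

Definition Ffree (n : nat) (w : 'I_n -> V) : Prop :=
  forall a : 'I_n -> gEnd, Fcomb a w = 0%R -> forall i (v : V), a i v = 0%R.

Definition Fbasis (W : {set V}) (n : nat) (w : 'I_n -> V) : Prop :=
  Ffree w /\ forall v : V, v \in W <-> exists a : 'I_n -> gEnd, v = Fcomb a w.

(* dim_F W = n; F is a division ring by Schur's lemma, so n is unique. *)
Definition Fdim (W : {set V}) (n : nat) : Prop :=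
  exists w : 'I_n -> V, Fbasis W w.

Definition gamma_module (gamma : nat) : Prop :=
  forall W : {set V}, Fsubspace W ->
  exists Ws : {set V},
    [/\ Fsubspace Ws,
        exists2 n : nat, Fdim Ws n & (n <= gamma)%N
      & 'C_G(W | to) =
          'C_G(Ws | to)
          :&: (G :&: \bigcap_(M : {group gT} |
                               maximal M G && ('C_G(W | to) \subset M)) M)].

(* V is G-isomorphic to X_M / Y_M, where Y_M = gcore M G and X_M / Y_M is the
   socle of G / Y_M, on which G acts by conjugation. *)
Definition iso_to_socle (M : {group gT}) : Prop :=
  exists phi : {morphism [set: V] >-> coset_of (gcore M G)},
    isom [set: V] (socle (G / gcore M G)) phi
    /\ forall g v, g \in G -> phi (to v g) = phi v ^ coset (gcore M G) g.

Definition in_VH (H : {group gT}) : Prop :=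
  exists M : {group gT}, [/\ maximal M G, H \subset M & iso_to_socle M].

End IrreducibleModules.

(* Main.v *)
Require Import Defs.
From HB Require Import structures.
From mathcomp Require Import all_boot all_order all_algebra.
From mathcomp Require Import all_fingroup all_solvable.

(* Write Y_M for the core of a maximal subgroup M and X_M / Y_M for the socle
   of G / Y_M, so that X_M is the centralizer of X_M / Y_M and M complements it.
   Choose a minimal set S of maximal subgroups containing H such that, for each
   maximal M containing H, the cores Y_k with k in S and X_k = X_M meet inside
   Y_M. Minimality makes the indices |G : k|, k in S, multiply to the index of
   the intersection of S, hence to at most |G : H|.
   If M contains H, there is k in S with X_k / Y_k isomorphic to X_M / Y_M, and
   the intersection T of the j in S with X_j = X_M complements X_M modulo
   Y_M. Complements being conjugate, T :&: M is the centralizer in T of a vector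
   of X_k / Y_k, which is fixed by H. Let W be the space of all vectors of
   X_k / Y_k fixed by H. A basis of W* gives at most gamma conjugates of k that
   contain H and cut out the centralizer of W* in T. The maximal subgroups
   needed to come down from there to the centralizer of W contain X_k, so their
   crowns X are strictly larger and descending induction on |X| applies to them.
   Every k in S contributes a factor at most |G : k| ^ (gamma + 1). *)

Set Implicit Arguments.
Unset Strict Implicit.
Unset Printing Implicit Defensive.

Import GroupScope GRing.Theory.

(** * Solvable primitive groups and the conjugacy of complements of the socle *)

Section Primitive.

Variables (gT : finGroupType) (G M : {group gT}).
Hypotheses (solG : solvable G) (maxM : maximal M G).

Lemma maximal_sub : M \subset G.
Proof. exact: proper_sub (maxgroupp maxM). Qed.

Lemma maximal_mul_normal (N : {group gT}) :
  N <| G -> ~~ (N \subset M) -> N * M = G.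
Proof.
case/andP=> sNG nNG not_sNM; have /maxgroupP[_ maxM'] := maxM.
have nNM := subset_trans maximal_sub nNG.
apply/eqP; rewrite eqEsubset mul_subG ?maximal_sub // -norm_joinEr //.
apply: contraR not_sNM => not_sG.
rewrite -(maxM' (N <*> M)%G) ?joing_subl ?joing_subr //.
by rewrite properE join_subG sNG maximal_sub.
Qed.

Hypothesis core1 : forall K : {group gT}, K <| G -> K \subset M -> K :=: 1.

Section MinNormal.

Variable A : {group gT}.
Hypotheses (minA : minnormal A G) (sAG : A \subset G).

Lemma prim_normal : A <| G.
Proof. by have /andP[_ nA] := mingroupp minA; apply/andP. Qed.

Lemma prim_abelian : abelian A.
Proof.
have [_ _] := minnormal_solvable minA sAG solG.
by case/is_abelemP=> p _ /abelem_abelian.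
Qed.

Lemma prim_mul : A * M = G.
Proof.
apply: maximal_mul_normal prim_normal _; apply/negP=> /(core1 prim_normal)/eqP.
by have /andP[/negPf->] := mingroupp minA.
Qed.

(** [M] normalizes [M :&: K] and [A] centralizes it, so [A * M = G] normalizes it and core-freeness
    applies. *)
Lemma prim_tiC (K : {group gT}) :
  G \subset 'N(K) -> M :&: K \subset 'C(A) -> M :&: K = 1.
Proof.
move=> nKG cAK; apply: core1 (subsetIl _ _).
rewrite /normal subIset ?maximal_sub // -prim_mul mul_subG //.
  by rewrite cents_norm // centsC.
by rewrite normsI ?normG // (subset_trans maximal_sub).
Qed.

Lemma prim_ti : M :&: A = 1.
Proof.
apply: prim_tiC; first exact: normal_norm prim_normal.
by rewrite subIset // [A \subset _]prim_abelian orbT.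
Qed.

Lemma prim_self_cent : 'C_G(A) = A.
Proof.
have sA : A \subset 'C_G(A) by rewrite subsetI sAG; exact: prim_abelian.
have := prim_mul => /esym eG.
have E: 'C_G(A) = A * (M :&: 'C_G(A)).
  by rewrite -{1}(setIidPr (subsetIl G 'C(A))) {1}eG -group_modl.
rewrite E prim_tiC ?mulg1 //; last by rewrite subIset // subsetIr orbT.
by rewrite normsI ?normG ?norms_cent ?(normal_norm prim_normal).
Qed.

(** Otherwise [N] and [A] meet trivially and hence commute, so that [N] lies in ['C_G(A) = A] and is
    trivial. *)
Lemma prim_normal_sub (N : {group gT}) : N <| G -> N :!=: 1 -> A \subset N.
Proof.
move=> nN ntN; have [/andP[ntA nAG] minA'] := mingroupP minA.
have [AN1|ntAN] := eqVneq (A :&: N) 1; last first.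
  rewrite -(minA' (A :&: N)%G) ?subsetIr ?subsetIl // ntAN.
  by rewrite normsI // normal_norm.
have cNA : N \subset 'C(A).
  apply/commG1P/trivgP; rewrite -AN1 setIC commg_subI // subsetI subxx.
    exact: subset_trans (normal_sub nN) (nAG).
  exact: subset_trans sAG (normal_norm nN).
have sNA : N \subset A by rewrite -prim_self_cent subsetI (normal_sub nN).
by case/eqP: ntN; rewrite -AN1 (setIidPr sNA).
Qed.

Lemma prim_socle : socle G = A.
Proof.
apply/eqP; rewrite eqEsubset gen_subG; apply/andP; split.
  apply/bigcupsP=> N /andP[minN sNG].
  have /andP[ntN nN] := mingroupp minN.
  have nNG : N <| G by apply/andP.
  have sAN := prim_normal_sub nNG ntN.
  have [_ minN'] := mingroupP minN.
  by rewrite -(minN' A) //; exact: mingroupp minA.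
by apply: sub_gen; apply: (bigcup_max A); rewrite ?minA.
Qed.

End MinNormal.

Lemma prim_minnormal_socle :
  minnormal (socle G) G /\ socle G \subset G.
Proof.
have ntG : G :!=: 1.
  apply: contraTneq (maxgroupp maxM) => ->.
  by rewrite properE sub1G andbF.
have [A minA sAG] := minnormal_exists ntG (normG G).
by rewrite (prim_socle minA).
Qed.

Section Complements.

Variables A K : {group gT}.
Hypotheses (minA : minnormal A G) (sAG : A \subset G).
Hypotheses (mulAK : A * K = G) (tiKA : K :&: A = 1).

(** Let [L / A] be a minimal normal subgroup of [G / A], a [q]-group. Every complement of [A] meets
    [L] in a Sylow [q]-subgroup of [L], so [K :&: L] and [M :&: L] are conjugate, and [M] is
    recovered as the normalizer of [M :&: L]. *)
Lemma prim_compl_conj : exists2 a, a \in A & K :=: M :^ a.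
Proof.
have nA := prim_normal minA sAG; have nAG := normal_norm nA.
have mulAM := prim_mul minA sAG; have tiMA := prim_ti minA sAG.
have cAA := prim_abelian minA sAG; have CA := prim_self_cent minA sAG.
have sKG : K \subset G by rewrite -mulAK mulG_subr.
have sMG := maximal_sub.
have [eAG|neAG] := eqVneq A G.
  exists 1; rewrite // conjsg1.
  by rewrite -(setIidPl sMG) -(setIidPl sKG) -eAG tiKA tiMA.
have ntQ : G / A != 1.
  apply: contra neAG => /eqP Q1; rewrite -val_eqE eqEsubset sAG /=.
  by rewrite -quotient_sub1 // Q1.
have [B minB sBQ] := minnormal_exists ntQ (normG _).
have [_ ntB abelB] := minnormal_solvable minB sBQ (quotient_sol _ solG).
have [q q_pr /and3P[qB _ _]] := is_abelemP abelB.
have /andP[_ nBQ] := mingroupp minB.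
have nBG : B <| G / A by apply/andP.
have [L defB sAL nLG] := inv_quotientN nA nBG.
have sLG := normal_sub nLG.
have qLA : q.-group (L / A) by rewrite -defB.
have not_sLA : ~~ (L \subset A).
  apply: contra ntB => sLA.
  by rewrite defB -subG1 quotient_sub1 // (subset_trans sLG).
have [_ ntA abelA] := minnormal_solvable minA sAG solG.
have [p p_pr /and3P[pA _ _]] := is_abelemP abelA.
have cLA1 : 'C_A(L) = 1.
  apply/eqP; apply: contraR not_sLA => ntC.
  have [_ minA'] := mingroupP minA.
  have CAL : 'C_A(L) = A.
    apply: (minA' 'C_A(L)%G) (subsetIl _ _).
    by rewrite ntC normsI ?norms_cent ?(normal_norm nLG).
  rewrite -CA subsetI sLG centsC -{1}CAL.
  exact: subsetIr.
(* With [p = q] the group [L] would be a [p]-group, and its normal subgroup [A] would meet the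
   centre nontrivially, against [cLA1]. *)
have neq_pq : p != q.
  apply: contraTneq ntA => e_pq; rewrite negbK.
  have pL : p.-group L.
    rewrite /pgroup -(Lagrange sAL) pnatM; apply/andP; split; first exact: pA.
    rewrite -card_quotient ?(subset_trans sLG) // e_pq; exact: qLA.
  have nAL : A <| L by rewrite /normal sAL (subset_trans sLG).
  apply/eqP/(TI_center_nil (pgroup_nil pL) nAL).
  by rewrite /center setIA (setIidPl sAL).
have syl (K1 : {group gT}) : A * K1 = G -> K1 :&: A = 1 ->
    q.-Sylow(L) (K1 :&: L).
  move=> mulK tiK.
  have eL : A * (K1 :&: L) = L by rewrite group_modl // mulK (setIidPr sLG).
  have tiL : (K1 :&: L) :&: A = 1.
    by apply/trivgP; rewrite -tiK setSI ?subsetIl.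
  have qK : q.-group (K1 :&: L).
    have nAK : K1 :&: L \subset 'N(A).
      by rewrite subIset // (subset_trans sLG) ?orbT.
    have: isog (K1 :&: L) ((K1 :&: L) / A) by rewrite quotient_isog // setIC.
    move/card_isog; rewrite /pgroup => ->.
    by apply: pgroupS qLA; rewrite quotientS ?subsetIr.
  have q'A : q^'.-group A.
    by apply: sub_pgroup pA => r; rewrite !inE => /eqP->.
  by have [] := coprime_mulGp_Hall eL q'A qK.
have sylM := syl M mulAM tiMA; have sylK := syl K mulAK tiKA.
have [x Lx eK] := Sylow_trans sylM sylK.
have nKL (K1 : {group gT}) : K1 \subset G -> K1 \subset 'N(K1 :&: L).
  by move=> sK1; rewrite normsI ?normG // (subset_trans sK1) ?normal_norm.
have eL : (M :&: L) * A = L.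
  rewrite normC; last by rewrite subIset // (subset_trans sLG) ?orbT.
  by rewrite group_modl // mulAM (setIidPr sLG).
move: Lx; rewrite -eL => /mulsgP[m a /setIP[Mm Lm] Aa def_x].
exists a => //.
have {}eK : K :&: L = (M :&: L) :^ a.
  by rewrite eK def_x conjsgM [(M :&: L) :^ m]conjGid // inE Mm.
have nAP : M :&: L \subset 'N(A) by rewrite subIset // (subset_trans sLG) ?orbT.
(* An element of [A] normalizing [M :&: L] has its commutators with it in [A :&: (M :&: L) = 1]; as
   [A] is abelian, it centralizes [(M :&: L) * A = L]. *)
have tiN : 'N_A(M :&: L) = 1.
  apply/trivgP; rewrite -cLA1 subsetI subsetIl /=.
  rewrite centsC -{1}eL mulG_subG; apply/andP; split; last first.
    by rewrite centsC subIset // [A \subset _]cAA.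
  rewrite centsC; apply/commG1P/trivgP.
  have tiPA : A :&: (M :&: L) = 1.
    by apply/trivgP; rewrite -tiMA /= setIC setSI ?subsetIl.
  by rewrite -tiPA commg_subI // subsetI subxx.
have NP : 'N_G(M :&: L) = M.
  by rewrite setIC -mulAM -group_modr ?nKL // setIC tiN mul1g.
apply/eqP; rewrite eqEcard; apply/andP; split.
  rewrite -NP conjIg -normJ -eK subsetI nKL // andbT.
  by rewrite conjGid ?(subsetP sAG).
have cM : (#|A| * #|M| = #|G|)%N.
  by rewrite -[in RHS]mulAM TI_cardMg // setIC.
have cK : (#|A| * #|K| = #|G|)%N.
  by rewrite -[in RHS]mulAK TI_cardMg // setIC.
by rewrite cardJg -(leq_pmul2l (cardG_gt0 A)) cM cK.
Qed.

End Complements.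
End Primitive.

(** * Crowns of maximal subgroups, lifted from the primitive quotients *)

Canonical socle_group (gT : finGroupType) (K : {set gT}) : {group gT} :=
  Eval hnf in [group of socle K].

Definition crown (gT : finGroupType) (G M : {group gT}) : {group gT} :=
  (coset (gcore M G) @*^-1 socle (G / gcore M G))%G.

Section Crown.

Variables (gT : finGroupType) (G : {group gT}).
Hypothesis solG : solvable G.

Section OneMaximal.

Variable M : {group gT}.
Hypothesis maxM : maximal M G.

Local Notation Y := (gcore M G).
Local Notation X := (crown G M).

Lemma core_normal : Y <| G.
Proof. exact: gcore_normal (maximal_sub maxM). Qed.

Lemma core_norm : G \subset 'N(Y).
Proof. exact: gcore_norm. Qed.

Lemma quotient_core_maximal : maximal (M / Y) (G / Y).
Proof.
by rewrite quotient_maximal ?gcore_normal ?maximal_sub // /normal gcore_sub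
   (subset_trans (maximal_sub maxM)) ?core_norm.
Qed.

Lemma quotient_core1 (K : {group coset_of Y}) :
  K <| G / Y -> K \subset M / Y -> K :=: 1.
Proof.
move=> nK; have [L -> sYL nL] := inv_quotientN core_normal nK.
have nLY := subset_trans (normal_sub nL) core_norm.
rewrite quotientSGK ?gcore_sub // => sLM; apply/trivgP.
by rewrite quotient_sub1 // gcore_max ?normal_norm.
Qed.

Lemma quotient_core_sol : solvable (G / Y).
Proof. exact: quotient_sol. Qed.

Lemma minnormal_socle : minnormal (socle (G / Y)) (G / Y).
Proof.
by have [] := prim_minnormal_socle quotient_core_sol quotient_core_maximal
  quotient_core1.
Qed.

Lemma socle_sub : socle (G / Y) \subset G / Y.
Proof.
by have [] := prim_minnormal_socle quotient_core_sol quotient_core_maximal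
  quotient_core1.
Qed.

Lemma abelian_socle : abelian (socle (G / Y)).
Proof. exact: (prim_abelian quotient_core_sol minnormal_socle socle_sub). Qed.

Lemma socle_self_cent : 'C_(G / Y)(socle (G / Y)) = socle (G / Y).
Proof.
exact: (prim_self_cent quotient_core_sol quotient_core_maximal
          quotient_core1 minnormal_socle socle_sub).
Qed.

Lemma crown_normal : X <| G.
Proof.
by rewrite -(quotientGK core_normal) cosetpre_normal
   (prim_normal minnormal_socle socle_sub).
Qed.

Lemma crown_quotient : X / Y = socle (G / Y).
Proof. exact: cosetpreK. Qed.

Lemma sub_core_crown : Y \subset X.
Proof. exact: sub_cosetpre. Qed.

Lemma crown_norm_core : X \subset 'N(Y).
Proof. exact: subset_trans (normal_sub crown_normal) core_norm. Qed.

Lemma crown_not_sub_core : ~~ (X \subset Y).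
Proof.
have /andP[ntS _] := mingroupp minnormal_socle.
by rewrite -quotient_sub1 ?crown_norm_core // crown_quotient subG1.
Qed.

(** The image of [K] in the minimal normal subgroup [X / Y] of [G / Y] is invariant and nontrivial,
    hence everything. *)
Lemma crown_mulM (K : {group gT}) :
  K <| G -> K \subset X -> ~~ (K \subset Y) -> K * Y = X.
Proof.
move=> nK sKX not_sKY; have nKY := subset_trans sKX crown_norm_core.
have [_ minS] := mingroupP minnormal_socle.
apply/eqP; rewrite eqEsubset mul_subG ?sub_core_crown // andTb.
rewrite (normC nKY) -quotientSK ?crown_norm_core // crown_quotient.
rewrite -(minS (K / Y)%G) //=; last by rewrite -crown_quotient quotientS.
by rewrite -subG1 quotient_sub1 // not_sKY quotient_norms ?normal_norm.
Qed.

Lemma maximal_cap_crown : M :&: X = Y.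
Proof.
apply/eqP; rewrite eqEsubset subsetI gcore_sub sub_core_crown !andbT.
have nMXY : M :&: X \subset 'N(Y) := subset_trans (subsetIr _ _) crown_norm_core.
rewrite -quotient_sub1 //.
apply: subset_trans (quotientI _ M X) _; rewrite crown_quotient.
by rewrite (prim_ti quotient_core_sol quotient_core_maximal quotient_core1
             minnormal_socle socle_sub).
Qed.

Lemma crown_abelian : [~: X, X] \subset Y.
Proof.
rewrite -quotient_cents2 ?crown_norm_core // crown_quotient.
exact: abelian_socle.
Qed.

Lemma crown_cent (K : {group gT}) :
  K \subset G -> [~: K, X] \subset Y -> K \subset X.
Proof.
move=> sKG; rewrite -quotient_cents2 ?crown_norm_core //; last first.
  exact: subset_trans core_norm.
rewrite crown_quotient => cK.
have sKQ : K / Y \subset 'C_(G / Y)(socle (G / Y)) by rewrite subsetI quotientS.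
rewrite -sub_quotient_pre; last exact: subset_trans core_norm.
by rewrite socle_self_cent in sKQ.
Qed.

Lemma complement_conj (T : {group gT}) :
    T \subset G -> X * T = G -> T :&: X \subset Y ->
  exists2 x, x \in X & T * Y = M :^ x.
Proof.
move=> sTG mulXT tiTX; have nTY := subset_trans sTG core_norm.
have mulQ : socle (G / Y) * (T / Y) = G / Y.
  by rewrite -crown_quotient -quotientMl ?mulXT ?crown_norm_core.
have tiQ : (T / Y) :&: socle (G / Y) = 1.
  rewrite -crown_quotient -quotientIG ?sub_core_crown //.
  by apply/trivgP; rewrite quotient_sub1 // subIset ?nTY.
have [xb Sxb eT] := prim_compl_conj quotient_core_sol quotient_core_maximal
  quotient_core1 minnormal_socle socle_sub mulQ tiQ.
have: xb \in X / Y by rewrite crown_quotient.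
case/morphimP=> x nYx Xx def_xb; exists x => //.
have nYM : Y <| M.
  by rewrite /normal gcore_sub (subset_trans (maximal_sub maxM)) ?core_norm.
have nYMx : Y <| M :^ x by rewrite -(normP nYx) normalJ.
rewrite (normC nTY) -quotientK //= -(quotientGK nYMx); congr (_ @*^-1 _).
by rewrite eT def_xb quotientJ.
Qed.

End OneMaximal.
End Crown.

(** * Families of maximal subgroups: complements, independence, indices *)

Section Families.

Variables (gT : finGroupType) (G : {group gT}).
Hypothesis solG : solvable G.

Implicit Types (M K N T A : {group gT}) (S : {set {group gT}}).

Local Notation Y M := (gcore M G).
Local Notation X M := (crown G M).

(** [t ^ c = t * [~ t, c]] with the commutator in [X M], and [M :&: X M = Y M]. Hence a conjugate of
    [M] under its crown cuts out of [M] the centralizer of a vector of [X M / Y M]. *)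
Lemma mem_conj_crown M t c : maximal M G ->
  t \in M -> c \in X M -> (t \in M :^ c^-1) = ([~ t, c] \in Y M).
Proof.
move=> maxM Mt Xc; rewrite mem_conjgV.
have Gt : t \in G := subsetP (maximal_sub maxM) _ Mt.
have nXG := normal_norm (crown_normal solG maxM).
have Xtc : [~ t, c] \in X M.
  by rewrite commgEr groupM // memJ_norm ?groupV // (subsetP nXG).
by rewrite conjg_mulR groupMl // -(maximal_cap_crown solG maxM) inE Xtc andbT.
Qed.

(** [T] and [M] are conjugate modulo [Y M] by an element of [X M = A * Y M]. Its part in [A]
    suffices, and gives a vector whose centralizer in [T] is [T :&: M]. *)
Lemma complement_cap_maximal M T A : maximal M G ->
    T \subset G -> X M * T = G -> T :&: X M \subset Y M ->
    A <| G -> A * Y M = X M ->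
  exists2 c, c \in A & {in T, forall t, (t \in M) = ([~ t, c] \in Y M)}.
Proof.
move=> maxM sTG mulXT tiTX nA mulAY.
have nY := core_normal maxM; have nX := crown_normal solG maxM.
have [x Xx eTY] := complement_conj solG maxM sTG mulXT tiTX.
have nTY : T \subset 'N(Y M) := subset_trans sTG (normal_norm nY).
have nAY : A \subset 'N(Y M) := subset_trans (normal_sub nA) (normal_norm nY).
have: x^-1 \in Y M * A by rewrite -(normC nAY) mulAY groupV.
case/mulsgP=> y a Yy Aa def_xV; exists a^-1; first by rewrite groupV.
have eM : M :=: (T <*> gcore_group M G) :^ a.
  apply: (canRL (conjsgKV _)).
  rewrite -(@conjGid _ (T <*> gcore_group M G)%G y); last first.
    exact: subsetP (joing_subr _ _) _ Yy.
  rewrite /= norm_joinEl // eTY -conjsgM; congr (_ :^ _).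
  by rewrite -[x]invgK def_xV invMg mulgKV.
move=> t Tt; have Gt := subsetP sTG _ Tt.
have Ga : a \in G := subsetP (normal_sub nA) _ Aa.
rewrite {1}eM mem_conjg conjg_mulR groupMl; last exact: subsetP (joing_subl _ _) _ Tt.
have Xta : [~ t, a^-1] \in X M.
  have Xa : a \in X M by rewrite -mulAY (subsetP (mulG_subl _ _)).
  rewrite commgEr groupM ?memJ_norm ?groupV //.
  by rewrite (subsetP (normal_norm nX)).
apply/idP/idP=> [Jta | Yta]; last exact: subsetP (joing_subr _ _) _ Yta.
(* Dedekind's law: [(Y M * T) :&: X M = Y M * (T :&: X M)], which is [Y M]. *)
have: [~ t, a^-1] \in (Y M * T) :&: X M.
  by rewrite inE Xta andbT -(normC nTY) -norm_joinEl.
rewrite -group_modl ?sub_core_crown // => /mulsgP[u v Yu TXv ->].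
by rewrite groupM // (subsetP tiTX).
Qed.

(* Otherwise X M' would centralize X M / Y M: that quotient is covered by
   N :&: X M' or by N, and [~: X M', -] maps either into Y M. *)
Lemma cap_core_not_sub M M' N : maximal M G -> maximal M' G ->
    N <| G -> N \subset X M -> ~~ (N \subset Y M) -> ~~ (X M' \subset X M) ->
  ~~ (N :&: Y M' \subset Y M).
Proof.
move=> maxM maxM' nN sNX not_sNY; apply: contra => sNYY.
have nX' := crown_normal solG maxM'.
have cent (B : {group gT}) : B <| G -> B \subset X M -> ~~ (B \subset Y M) ->
    [~: X M', B] \subset Y M -> X M' \subset X M.
  move=> nB sBX not_sBY.
  have nXY := normal_norm (core_normal maxM) => sXBY.
  have nBY := subset_trans (normal_sub nB) nXY.
  have nX'Y := subset_trans (normal_sub nX') nXY.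
  apply: (crown_cent solG maxM (normal_sub nX')).
  rewrite -quotient_cents2 ?crown_norm_core //.
  rewrite -(crown_mulM solG maxM nB sBX not_sBY) quotientMidr.
  by rewrite quotient_cents2.
have nNX' : N :&: X M' <| G by rewrite normalI.
have [sNX'Y|not_sNX'Y] := boolP (N :&: X M' \subset Y M).
  apply: (cent N) => //; apply: subset_trans sNX'Y.
  rewrite commGC; apply: commg_subI; rewrite subsetI subxx.
    exact: subset_trans (normal_sub nN) (normal_norm nX').
  exact: subset_trans (normal_sub nX') (normal_norm nN).
apply: (cent (N :&: X M')%G) => //; first by rewrite subIset ?sNX.
apply: subset_trans sNYY; rewrite subsetI; apply/andP; split.
  apply: subset_trans (commgS _ (subsetIl _ _)) _.
  by rewrite commg_subr (subset_trans (normal_sub nX')) ?normal_norm.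
apply: subset_trans (commgS _ (subsetIr _ _)) _.
exact: crown_abelian.
Qed.

(** [N :&: Y M'] inherits the hypotheses on [N], so the cores can be intersected one at a time. *)
Lemma cap_cores_not_sub M (s : seq {group gT}) N : maximal M G ->
    {in s, forall M', maximal M' G /\ ~~ (X M' \subset X M)} ->
    N <| G -> N \subset X M -> ~~ (N \subset Y M) ->
  ~~ (N :&: \bigcap_(M' <- s) Y M' \subset Y M).
Proof.
move=> maxM; elim: s N => [|M' s IHs] N maxs nN sNX not_sNY.
  by rewrite big_nil setIT.
rewrite big_cons setIA.
have [maxM' not_sXX] := maxs M' (mem_head _ _).
apply: (IHs (N :&: gcore_group M' G)%G) => [M2 sM2|||].
- by apply: maxs; rewrite inE sM2 orbT.
- by rewrite normalI // core_normal.
- by rewrite subIset ?sNX.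
exact: cap_core_not_sub.
Qed.

(** The witness [N] says that, within one crown, no core contains the intersection of the crown with
    the other cores. Members with other crowns are handled by [cap_cores_not_sub]. *)
Definition independent S := forall M, M \in S -> maximal M G /\
  exists N, [/\ N <| G, N \subset X M, ~~ (N \subset Y M)
    & {in S, forall M', M' != M -> X M' = X M -> N \subset Y M'}].

Lemma independentS S S' : S' \subset S -> independent S -> independent S'.
Proof.
move=> sSS indS M SM; have [maxM [N [nN sNX nsNY NY]]] := indS M (subsetP sSS M SM).
by split=> //; exists N; split=> // M' SM'; apply: NY; apply: (subsetP sSS).
Qed.

Definition interG S : {group gT} := (G :&: \bigcap_(M in S) M)%G.

Lemma interGD1 S M : M \in S -> interG S :=: interG (S :\ M) :&: M.
Proof. by move=> SM; rewrite /= (big_setD1 M) //= setICA setIC. Qed.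

(** Remove [M1] from [S] and let [I] be the intersection of the rest. The witness [N] of [M1] lies
    in [I] and [N * M1 = G], so [I = N * (I :&: M1)], and [N] is absorbed by [X M]. *)
Lemma interG_mul_crown S M : independent S ->
  {in S, forall M', X M' = X M} -> maximal M G -> X M * interG S = G.
Proof.
move=> indS eqX maxM; move: {2}_.+1 (ltnSn #|S|) => n.
elim: n => // n IHn in S indS eqX *; rewrite ltnS => leSn.
have sXG := normal_sub (crown_normal solG maxM).
have [->|[M1 SM1]] := set_0Vmem S.
  by rewrite /interG /= big_set0 setIT mulSGid.
have sD := subsetDl S [set M1].
have {}IHn : X M * interG (S :\ M1) = G.
  apply: IHn; first exact: independentS indS.
    by move=> M2 /(subsetP sD)/eqX.
  by apply: leq_trans leSn; rewrite [leqRHS](cardsD1 M1) SM1.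
have [maxM1 [N [nN sNX nsNY NY]]] := indS M1 SM1.
have mulNM : N * M1 = G.
  apply: maximal_mul_normal => //; apply: contra nsNY => sNM.
  by rewrite gcore_max ?normal_norm.
have sNI : N \subset interG (S :\ M1).
  rewrite subsetI normal_sub //=; apply/bigcapsP=> M2 /setD1P[neq SM2].
  by rewrite (subset_trans _ (gcore_sub M2 G)) // NY // (eqX M1) ?eqX.
rewrite (interGD1 SM1).
have eT : N * (interG (S :\ M1) :&: M1) = interG (S :\ M1).
  by rewrite setIC group_modl // mulNM (setIidPr (subsetIl _ _)).
have sNXM : N \subset X M by rewrite -(eqX M1).
by rewrite -[RHS]IHn -[in RHS]eT mulgA (mulGSid sNXM).
Qed.

Lemma bigcap_core_normal (P : pred {group gT}) N :
    N <| G -> (forall M, P M -> maximal M G) ->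
  (N :&: \bigcap_(M | P M) gcore M G)%G <| G.
Proof.
move=> /andP[sNG nNG] maxP; rewrite /normal subIset ?sNG //=.
rewrite normsI // norms_bigcap //.
by apply/bigcapsP=> M _; exact: gcore_norm.
Qed.

(** Indices multiply once [M * I = G], with [I] the intersection of the other members; for this a
    normal subgroup of [G] inside [I] but not inside [M] is enough. *)
Lemma indexg_interG S : independent S ->
  (\prod_(M in S) #|G : M| = #|G : interG S|)%N.
Proof.
move: {2}_.+1 (ltnSn #|S|) => n.
elim: n => // n IHn in S *; rewrite ltnS => leSn indS.
have [->|[M0 SM0]] := set_0Vmem S.
  by rewrite big_set0 /interG /= big_set0 setIT indexgg.
(* With the smallest crown, [X M] contains no different crown of the family, as [cap_cores_not_sub]
   requires. *)
have [/= M SM minM] := @arg_minnP _ M0 (mem S) (fun M => #|X M|) SM0.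
have sD := subsetDl S [set M].
have [maxM [N [nN sNX nsNY NY]]] := indS M SM.
have {}IHn : (\prod_(M' in S :\ M) #|G : M'| = #|G : interG (S :\ M)|)%N.
  apply: IHn; last exact: independentS indS.
  by apply: leq_trans leSn; rewrite [leqRHS](cardsD1 M) SM.
rewrite (big_setD1 M) //= IHn.
pose P := [pred M' | (M' \in S :\ M) && (X M' != X M)].
have maxP M' : P M' -> maximal M' G.
  by case/andP=> /setD1P[_ /indS[]].
pose Z := (N :&: \bigcap_(M' | P M') gcore M' G)%G.
have nZ : Z <| G by exact: bigcap_core_normal.
have nsZY : ~~ (Z \subset Y M).
  rewrite /Z /= -big_enum.
  apply: cap_cores_not_sub => // M'; rewrite mem_enum => PM'.
  split; first exact: maxP.
  case/andP: PM' => /setD1P[_ SM']; apply: contra => sXX.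
  by rewrite -val_eqE eqEcard sXX minM.
have mulZM : Z * M = G.
  apply: maximal_mul_normal => //; apply: contra nsZY => sZM.
  by rewrite gcore_max ?normal_norm.
have sZI : Z \subset interG (S :\ M).
  rewrite subsetI normal_sub //=; apply/bigcapsP=> M2 SM2.
  apply: subset_trans (gcore_sub M2 G).
  have [eqX|neqX] := eqVneq (X M2) (X M).
    by case/setD1P: SM2 => neq SM2; rewrite subIset // NY.
  rewrite /Z /= subIset //; apply/orP; right.
  by apply: (bigcap_inf M2); rewrite /= SM2.
rewrite (interGD1 SM).
set I := interG (S :\ M) in sZI *.
have mulMI : M * I = G.
  have sIG : I \subset G by exact: subsetIl.
  have nZM := subset_trans (maximal_sub maxM) (normal_norm nZ).
  apply/eqP; rewrite eqEsubset mul_subG ?(maximal_sub maxM) // andTb.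
  by apply: subset_trans (mulgS M sZI); rewrite normC // mulZM.
transitivity #|G : (I :&: M)%G|; last by [].
rewrite -(Lagrange_index (subsetIl _ _ : I \subset G) (subsetIl I M)) mulnC.
by rewrite (indexgI I M) -(indexMg M I) mulMI.
Qed.

(** Take [S'] minimal with the spanning property. Dropping [M] breaks it for some [M1], and the
    intersection of [X M1] with the remaining cores of that crown is the witness of independence for
    [M]. *)
Lemma independent_subfamily S : {in S, forall M, maximal M G} ->
  exists S', [/\ S' \subset S, independent S' & {in S, forall M,
    X M :&: \bigcap_(M' in S' | X M' == X M) Y M' \subset Y M}].
Proof.
move=> maxS.
pose P S' := (S' \subset S) && [forall M in S,
    X M :&: \bigcap_(M' in S' | X M' == X M) Y M' \subset Y M].
have PS : P S.
  rewrite /P subxx; apply/forall_inP=> M SM; rewrite subIset //; apply/orP; right.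
  by apply: (bigcap_inf M); rewrite SM /=.
have [S' /minsetP[/andP[sS'S /forall_inP spanS'] minS'] _] := minset_exists PS.
exists S'; split=> // M S'M; split; first by apply: maxS; apply: (subsetP sS'S).
have : ~~ P (S' :\ M).
  apply/negP=> /minS' => /(_ (subsetDl _ _)) eS.
  by have := S'M; rewrite -eS !inE eqxx.
rewrite negb_and (subset_trans (subsetDl _ _) sS'S) /=.
case/forallPn=> M1; rewrite negb_imply => /andP[SM1 not_sub].
pose Q := [pred M' | (M' \in S' :\ M) && (X M' == X M1)].
have nQ : (X M1 :&: \bigcap_(M' | Q M') gcore M' G)%G <| G.
  apply: bigcap_core_normal; first exact: crown_normal (maxS _ SM1).
  by move=> M' /andP[/setD1P[_ /(subsetP sS'S)/maxS]].
(* If the crowns differed, dropping [M] would not alter the intersection belonging to [M1]. *)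
have eqX : X M = X M1.
  apply/eqP; apply: contraR not_sub => neqX; apply: subset_trans (spanS' _ SM1).
  apply: setIS; apply/bigcapsP=> M' /andP[S'M' eqX'].
  apply: (bigcap_inf M'); rewrite !inE S'M' eqX' !andbT.
  by apply: contraNneq neqX => <-.
have sQX : (X M1 :&: \bigcap_(M' | Q M') gcore M' G)%G \subset X M.
  by rewrite eqX; exact: subsetIl.
exists (X M1 :&: \bigcap_(M' | Q M') gcore M' G)%G; split=> //.
- apply: contra not_sub => sNY; apply: subset_trans (spanS' _ SM1).
  rewrite subsetI subsetIl; apply/bigcapsP=> M' /andP[S'M' eqX'].
  have [->|neqM] := eqVneq M' M; first by [].
  rewrite subIset //; apply/orP; right.
  by apply: (bigcap_inf M'); rewrite !inE neqM S'M' eqX'.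
move=> M' S'M' neqM eqX'; rewrite subIset //; apply/orP; right.
by apply: (bigcap_inf M'); rewrite !inE neqM S'M' eqX' eqX /=.
Qed.

(** Let [J] be minimal with cores meeting [X M] inside [Y M], and [M'] in [J]. The intersection [A]
    of [X M] with the other cores of [J] covers [X M / Y M] and [X M / Y M'] with the same kernel,
    which encodes a [G]-isomorphism between them. *)
Lemma common_complement M S : maximal M G -> {in S, forall M', maximal M' G} ->
    {in S, forall M', X M' = X M} -> X M :&: \bigcap_(M' in S) Y M' \subset Y M ->
  exists2 M', M' \in S & exists A, [/\ A <| G, A * Y M = X M, A * Y M' = X M
    & A :&: Y M = A :&: Y M'].
Proof.
move=> maxM maxS eqX sYM.
pose P S' := (S' \subset S) && (X M :&: \bigcap_(M' in S') Y M' \subset Y M).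
have PS : P S by rewrite /P subxx.
have [J /minsetP[/andP[sJS sJY] minJ] _] := minset_exists PS.
have [J0|[M' JM']] := set_0Vmem J.
  case/negP: (crown_not_sub_core solG maxM).
  by rewrite J0 big_set0 setIT in sJY.
have SM' := subsetP sJS _ JM'; exists M' => //.
pose A := (X M :&: \bigcap_(M2 in J :\ M') gcore M2 G)%G.
have defA : A = X M :&: \bigcap_(M2 in J :\ M') gcore M2 G :> {set gT}.
  by [].
have nA : A <| G.
  apply: bigcap_core_normal; first exact: crown_normal.
  by move=> M2 /setD1P[_ /(subsetP sJS)/maxS].
have sAX : A \subset X M by rewrite defA subsetIl.
have nsAY : ~~ (A \subset Y M).
  apply/negP=> sAY; have: P (J :\ M').
    by rewrite /P (subset_trans (subsetDl _ _) sJS) -defA.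
  move/minJ => /(_ (subsetDl _ _)) eJ.
  by have := JM'; rewrite -eJ !inE eqxx.
have sAYY : A :&: Y M' \subset Y M.
  by rewrite defA -setIA [_ :&: Y M']setIC -(big_setD1 M' JM').
have nsAY' : ~~ (A \subset Y M').
  by apply: contra nsAY => sAY'; rewrite -(setIidPl sAY').
have mulAY := crown_mulM solG maxM nA sAX nsAY.
have mulAY' : A * Y M' = X M'.
  by apply: crown_mulM => //; [apply: maxS | rewrite eqX].
exists A; split=> //; first by rewrite mulAY' eqX.
apply/eqP; rewrite eq_sym eqEsubset subsetI subsetIl sAYY /=.
rewrite subsetI subsetIl /=.
have nYA : A :&: Y M <| G by rewrite normalI ?core_normal.
(* Otherwise [A :&: Y M] would cover [X M' / Y M'], and Dedekind's law would give
   [A = (A :&: Y M) * (A :&: Y M')], inside [Y M]. *)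
apply: contraR nsAY => nsAYY'.
have mulB : (A :&: Y M) * Y M' = X M'.
  by apply: (crown_mulM solG (maxS _ SM') nYA) => //; rewrite eqX // subIset ?sAX.
have: A \subset (A :&: Y M) * (A :&: Y M').
  rewrite [A :&: Y M']setIC group_modl ?subsetIl // mulB eqX //.
  by rewrite subsetI sAX subxx.
move/subset_trans; apply; rewrite mul_subG ?subsetIr //.
Qed.

End Families.

(** * Abelian chief factors as irreducible modules *)

(** The proof of commutativity is a parameter of this alias, so that the product of [A] can be
    declared as an addition on it. *)
Definition additive_of (gT : finGroupType) (A : {group gT}) (cA : abelian A) :=
  subg_of A.

Section AdditiveOf.

Variables (gT : finGroupType) (A : {group gT}) (cA : abelian A).

Local Notation V := (additive_of cA).

HB.instance Definition _ := Finite.on V.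

Lemma additive_mulC : commutative (fun x y : subg_of A => x * y).
Proof. by move=> x y; apply: val_inj => /=; apply: (centsP cA); apply: subgP. Qed.

HB.instance Definition _ := GRing.isZmodule.Build V
  (@mulgA (subg_of A)) additive_mulC (@mul1g (subg_of A)) (@mulVg (subg_of A)).

End AdditiveOf.

Section ChiefModule.

Variables (gT : finGroupType) (G Y : {group gT}) (A : {group coset_of Y}).
Hypotheses (nYG : G \subset 'N(Y)) (cA : abelian A) (minA : minnormal A (G / Y)).

Local Notation V := (additive_of cA : finZmodType).

(* [is_action] asks for injectivity at every element of gT, hence the trivial
   action outside G. *)
Definition chief_act (v : V) (g : gT) : V :=
  if g \in G then subg A (sgval v ^ coset Y g) else v.

Lemma chief_actE v g : g \in G -> sgval (chief_act v g) = sgval v ^ coset Y g.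
Proof.
move=> Gg; rewrite /chief_act Gg subgK //.
have /andP[_ nA] := mingroupp minA.
by rewrite memJ_norm ?subgP // (subsetP nA) ?mem_quotient.
Qed.

Lemma chief_act_is_action : is_action G chief_act.
Proof.
split=> [g x y|v g h Gg Gh].
  case Gg: (g \in G); last by rewrite /chief_act Gg.
  by move/(congr1 sgval); rewrite !chief_actE // => /conjg_inj /val_inj.
apply: val_inj; change (sgval (chief_act v (g * h)) = sgval (chief_act (chief_act v g) h)).
by rewrite !chief_actE ?groupM // morphM ?(subsetP nYG) // conjgM.
Qed.

Canonical chief_action := Action chief_act_is_action.

Lemma chief_act_is_groupAction : is_groupAction [set: V] chief_action.
Proof.
move=> g Gg; rewrite inE; apply/andP; split.
  by apply/subsetP=> x _; rewrite inE.
apply/morphicP=> x y _ _; rewrite !actpermE; apply: val_inj.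
change (sgval (chief_act (x * y) g) = sgval (chief_act x g) * sgval (chief_act y g)).
by rewrite !chief_actE // -conjMg.
Qed.

Canonical chief_groupAction := GroupAction chief_act_is_groupAction.

Lemma chief_act_irreducible : acts_irreducibly G [set: V] chief_groupAction.
Proof.
have [/andP[ntA nA] minA'] := mingroupP minA.
apply/mingroupP; split.
  apply/andP; split.
    apply: contra ntA => /eqP V1; apply/eqP/trivgP/subsetP=> a Aa.
    have: (subg A a : V) \in [set: V] by rewrite inE.
    rewrite V1 inE => /eqP/(congr1 sgval); rewrite subgK // => ->.
    by rewrite inE.
  by apply/subsetP=> g Gg; rewrite !inE Gg; apply/subsetP=> x; rewrite !inE.
move=> U /andP[ntU actU] _.
pose f : V -> coset_of Y := sgval.
have fM : {in [set: V] &, {morph f : x y / x * y}} by [].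
pose phi := Morphism fM.
have im1 : phi @* U = A.
  apply: minA'.
    apply/andP; split.
      apply: contra ntU => /eqP U1; apply/eqP/trivgP/subsetP=> u Uu.
      have : phi u \in phi @* U by rewrite mem_morphim ?inE.
      rewrite U1 inE => /eqP fu1; rewrite inE; apply/eqP; exact: val_inj.
    apply/subsetP=> _ /morphimP[g nYg Gg ->]; rewrite inE.
    apply/subsetP=> _ /imsetP[_ /morphimP[u _ Uu ->] ->].
    change (f u ^ coset Y g \in phi @* U).
    rewrite /f -chief_actE // -[sgval _]/(phi (chief_act u g)).
    rewrite mem_morphim ?inE //.
    by have := acts_act actU Gg u; rewrite Uu.
  by apply/subsetP=> _ /morphimP[u _ Uu ->]; exact: subgP.
apply/eqP; rewrite eqEsubset subsetT; apply/subsetP=> v _.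
have: f v \in phi @* U by rewrite im1 subgP.
by case/morphimP=> u _ Uu /val_inj ->.
Qed.

Definition chief_module := IrrModule chief_act_irreducible.
End ChiefModule.

(** * Endomorphisms, fixed vectors and the use of the [gamma]-property *)

Section EndG.

Variables (gT : finGroupType) (G : {group gT}) (V : irrModule G).
Local Notation to := (irr_act V).

Lemma gEnd_id_equivariant g (v : V) :
  g \in G -> idfun (to v g) = to (idfun v) g.
Proof. by []. Qed.

Definition gEnd_id : gEnd V := GEnd gEnd_id_equivariant.

Lemma irr_act0 g : g \in G -> to 0%R g = 0%R.
Proof. by move=> Gg; exact: (gact1 to Gg). Qed.

Lemma irr_actD g : g \in G -> {morph to^~ g : u v / (u + v)%R}.
Proof. by move=> Gg u v; apply: (gactM to Gg); rewrite inE. Qed.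

Lemma gEnd_zero_equivariant g (v : V) :
  g \in G -> (\0 : {additive V -> V})%R (to v g) = to ((\0 : {additive V -> V})%R v) g.
Proof. by move=> Gg; rewrite /= irr_act0. Qed.

Definition gEnd_zero : gEnd V := GEnd gEnd_zero_equivariant.

Lemma Fbasis_mem (W : {set V}) n (w : 'I_n -> V) i : Fbasis W w -> w i \in W.
Proof.
case=> _ spanW; apply/spanW.
exists (fun j => if j == i then gEnd_id else gEnd_zero).
rewrite /Fcomb (bigD1 i) //= eqxx big1 /= ?addr0 // => j /negPf->.
by [].
Qed.

Lemma Fbasis_fixed (W : {set V}) n (w : 'I_n -> V) g : Fbasis W w -> g \in G ->
  (forall i, to (w i) g = w i) -> g \in 'C_G(W | to).
Proof.
case=> _ spanW Gg fix_w; rewrite !inE Gg; apply/subsetP=> v /spanW[a ->].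
rewrite inE; apply/eqP; rewrite /Fcomb.
rewrite (big_morph _ (irr_actD Gg) (irr_act0 Gg)); apply: eq_bigr => i _.
by rewrite -gEnd_equivariant // fix_w.
Qed.

Definition fixed_by (H : {set gT}) : {set V} :=
  [set v | [forall h in H, to v h == v]].

Lemma fixed_byP (H : {set gT}) v :
  reflect {in H, forall h, to v h = v} (v \in fixed_by H).
Proof. by rewrite inE; apply: eqfun_inP. Qed.

Lemma fixed_by_Fsubspace (H : {group gT}) :
  H \subset G -> Fsubspace (fixed_by H).
Proof.
move=> /subsetP sHG; split.
- by apply/fixed_byP=> h /sHG; exact: irr_act0.
- move=> u v /fixed_byP fu /fixed_byP fv; apply/fixed_byP=> h Hh.
  by rewrite irr_actD ?sHG // fu ?fv.
by move=> a v /fixed_byP fv; apply/fixed_byP=> h Hh; rewrite -gEnd_equivariant ?sHG ?fv.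
Qed.

Lemma sub_cent_fixed_by (H : {group gT}) :
  H \subset G -> H \subset 'C_G(fixed_by H | to).
Proof.
move=> sHG; apply/subsetP=> h Hh; rewrite !inE (subsetP sHG) //.
by apply/subsetP=> v /fixed_byP fv; rewrite inE fv.
Qed.

(** The property is applied to the space of all vectors fixed by [H], and [w] is a basis of [Ws].
    Since [H] centralizes the former, it centralizes [Ws]; the clause on [D] is the inclusion into
    ['C_G(W | to)] from condition (2). *)
Lemma gamma_module_fixed_by (gamma : nat) (H : {group gT}) :
    gamma_module V gamma -> H \subset G ->
  exists2 n, n <= gamma & exists2 w : 'I_n -> V,
     (forall i, w i \in fixed_by H)
   & forall D : {set gT}, D \subset G ->
     {in D, forall d i, to (w i) d = w i} ->
     (forall M : {group gT}, maximal M G ->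
        'C_G(fixed_by H | to) \subset M -> D \subset M) ->
     D \subset 'C_G(fixed_by H | to).
Proof.
move=> gammaV sHG; have [Ws [_ [n [w bw] le_n] defC]] := gammaV _ (fixed_by_Fsubspace sHG).
exists n => //; exists w.
  move=> i; apply/fixed_byP=> h /(subsetP (sub_cent_fixed_by sHG)).
  rewrite defC inE => /andP[/setIP[_ Ch] _].
  exact: astab_act Ch (Fbasis_mem i bw).
move=> D sDG fixD maxD; rewrite defC; apply/subsetP=> d Dd.
have Gd := subsetP sDG d Dd; rewrite inE; apply/andP; split.
  by apply: (Fbasis_fixed bw) => // i; exact: fixD.
rewrite inE Gd; apply/bigcapP=> M /andP[maxM sCM].
exact: subsetP (maxD M maxM sCM) d Dd.
Qed.

End EndG.

(** * The module of a crown and its fixed vectors as commutator conditions *)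

Section CrownModule.

Variables (gT : finGroupType) (G M : {group gT}).
Hypotheses (solG : solvable G) (maxM : maximal M G).

Local Notation Y := (gcore_group M G).
Local Notation X := (crown G M).

Definition crown_module : irrModule G :=
  chief_module (core_norm G M : G \subset 'N(Y))
    (abelian_socle solG maxM : abelian (socle_group (G / Y)))
    (minnormal_socle solG maxM).

Local Notation V := crown_module.

Definition crown_vec (c : gT) : V := subg (socle_group (G / Y)) (coset Y c).

Definition crown_val (v : V) : coset_of Y :=
  sgval (v : subg_of (socle_group (G / Y))).

Lemma crown_val_inj : injective crown_val.
Proof. by move=> u v; exact: val_inj. Qed.

Lemma crown_vec_val c : c \in X ->
  crown_val (crown_vec c) = coset Y c.
Proof.
move=> Xc; apply: subgK.
have: coset Y c \in X / Y by exact: mem_quotient.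
by rewrite (crown_quotient G M).
Qed.

Lemma crown_vec_surj (v : V) : exists2 c, c \in X & v = crown_vec c.
Proof.
have: crown_val v \in X / Y.
  by rewrite (crown_quotient G M); exact: (subgP (v : subg_of (socle_group (G / Y)))).
case/morphimP=> c _ Xc eq_c; exists c => //.
by apply: crown_val_inj; rewrite [RHS]crown_vec_val.
Qed.

Lemma crown_vec_fixed c g : c \in X -> g \in G ->
  (irr_act V (crown_vec c) g = crown_vec c) <-> [~ g, c] \in Y.
Proof.
move=> Xc Gg.
have nYg := subsetP (core_norm G M) g Gg.
have nYc := subsetP (crown_norm_core solG maxM) c Xc.
have E : crown_val (irr_act V (crown_vec c) g) = coset Y (c ^ g).
  rewrite morphJ //= -(crown_vec_val Xc).
  exact: (chief_actE (minnormal_socle solG maxM) (crown_vec c) Gg).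
have -> : ([~ g, c] \in Y) = ([~ c, g] \in Y) by rewrite -groupV invg_comm.
split=> [fix_c | Ycg].
  apply: coset_idr; first by rewrite groupR.
  rewrite morphR //= -[RHS](mulVg (coset Y c)) commgEl -morphJ //= -E fix_c.
  by rewrite crown_vec_val.
apply: crown_val_inj; rewrite E crown_vec_val //.
by rewrite conjg_mulR morphM ?groupR //= (coset_id Ycg) mulg1.
Qed.

Lemma crown_module_iso : iso_to_socle V M.
Proof.
have fM : {in [set: V] &, {morph (crown_val : V -> coset_of (gcore M G)) :
    x y / x * y}} by [].
exists (Morphism fM); split; last first.
  by move=> g v Gg; exact: (chief_actE (minnormal_socle solG maxM)).
apply/isomP; split; first by apply/injmP=> u v _ _; exact: crown_val_inj.
apply/setP=> a; apply/morphimP/idP => [[v _ _ ->] | Sa].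
  exact: (subgP (v : subg_of (socle_group (G / Y)))).
exists (subg (socle_group (G / Y)) a : V); rewrite ?inE //.
by rewrite /= /crown_val subgK.
Qed.

(** Commutator form of [gamma_module_fixed_by]. A maximal subgroup containing the centralizer of the
    fixed vectors contains [H], and also [X], which acts trivially because [X / Y] is abelian. *)
Lemma gamma_crown (gamma : nat) (H : {group gT}) :
    H \subset M -> (forall V : irrModule G, in_VH V H -> gamma_module V gamma) ->
  exists2 n, n <= gamma & exists2 c : 'I_n -> gT,
    (forall i, c i \in X /\ {in H, forall h, [~ h, c i] \in Y})
  & forall D : {group gT}, D \subset G ->
    {in D, forall d i, [~ d, c i] \in Y} ->
    (forall M' : {group gT}, maximal M' G -> X \subset M' -> H \subset M' ->
       D \subset M') ->
    forall x, x \in X -> {in H, forall h, [~ h, x] \in Y} ->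
    {in D, forall d, [~ d, x] \in Y}.
Proof.
move=> sHM /(_ V) gammaV; have sHG := subset_trans sHM (maximal_sub maxM).
have {}gammaV : gamma_module V gamma.
  by apply: gammaV; exists M; split=> //; exact: crown_module_iso.
have [n le_n [w fix_w clos]] := gamma_module_fixed_by gammaV sHG.
exists n => //.
have [c Xc def_w] : exists2 c : 'I_n -> gT, (forall i, c i \in X)
    & (forall i, w i = crown_vec (c i)).
  have ex i : exists c, (c \in X) && (w i == crown_vec c).
    by have [c Xc ->] := crown_vec_surj (w i); exists c; rewrite Xc eqxx.
  exists (fun i => xchoose (ex i)) => i; have /andP[] := xchooseP (ex i) => //.
  by move=> _ /eqP.
exists c.
  move=> i; split=> // h Hh; apply/crown_vec_fixed; rewrite ?(subsetP sHG) //.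
  by rewrite -def_w; move/fixed_byP: (fix_w i) => ->.
move=> D sDG fixD maxD x Xx Hx d Dd; have Gd := subsetP sDG d Dd.
have Wx : crown_vec x \in fixed_by V H.
  apply/fixed_byP=> h Hh; apply/crown_vec_fixed; rewrite ?(subsetP sHG) //.
  exact: Hx.
apply/crown_vec_fixed => //.
suffices /subsetP/(_ d Dd)/setIP[_ Cd] : D \subset 'C_G(fixed_by V H | irr_act V).
  exact: astab_act Cd Wx.
apply: clos => // [d1 Dd1 i | M' maxM' sCM'].
  by rewrite def_w; apply/crown_vec_fixed; rewrite ?fixD ?(subsetP sDG).
apply: maxD => //; last exact: subset_trans (sub_cent_fixed_by V sHG) sCM'.
apply: subset_trans sCM'.
have sXG := normal_sub (crown_normal solG maxM).
apply/subsetP=> y Xy; rewrite !inE (subsetP sXG) //=.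
apply/subsetP=> v _; rewrite inE; have [z Xz ->] := crown_vec_surj v.
apply/eqP/crown_vec_fixed; rewrite ?(subsetP sXG) //.
by apply: subsetP (crown_abelian solG maxM) _ _; exact: mem_commg.
Qed.

End CrownModule.

(** * Conjugates of a maximal subgroup in place of vectors *)

Section Conjugates.

Variables (gT : finGroupType) (G : {group gT}).
Hypothesis solG : solvable G.

Local Notation Y M := (gcore M G).
Local Notation X M := (crown G M).

(* When M is one of the chosen maximal subgroups, s consists of the conjugates
   of M attached to a basis of W*. *)
Definition detects (gamma : nat) (H M : {group gT}) (s : seq {group gT}) :=
  [/\ size s <= gamma,
      forall M' : {group gT}, M' \in s ->
        [/\ maximal M' G, #|G : M'| = #|G : M| & H \subset M']
    & forall D : {group gT}, D \subset M ->
      (forall M' : {group gT}, M' \in s -> D \subset M') ->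
      (forall M' : {group gT}, maximal M' G -> X M \subset M' -> H \subset M' ->
         D \subset M') ->
      forall x, x \in X M -> {in H, forall h, [~ h, x] \in Y M} ->
      {in D, forall d, [~ d, x] \in Y M}].

(** By [mem_conj_crown], a subgroup of [M] lies in [M :^ (c i)^-1] exactly when it fixes the vector
    of [c i], so these conjugates replace the basis vectors. *)
Lemma gamma_conjugates (gamma : nat) (H M : {group gT}) :
    maximal M G -> H \subset M ->
    (forall V : irrModule G, in_VH V H -> gamma_module V gamma) ->
  exists s, detects gamma H M s.
Proof.
move=> maxM sHM /(gamma_crown solG maxM sHM)[n le_n [c Xc clos]].
have sXG := normal_sub (crown_normal solG maxM).
exists [seq (M :^ (c i)^-1)%G | i <- enum 'I_n]; split.
- by rewrite size_map size_enum_ord.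
- move=> _ /mapP[i _ ->]; have [Xci Hci] := Xc i.
  have GcG : G :^ (c i)^-1 = G by rewrite conjGid // groupV (subsetP sXG).
  split; first by rewrite -GcG maximalJ.
    by rewrite -{1}GcG /= indexJg.
  by apply/subsetP=> h Hh; rewrite /= (mem_conj_crown solG) ?(subsetP sHM) ?Hci.
move=> D sDM sDs maxD; apply: clos => //.
  exact: subset_trans sDM (maximal_sub maxM).
move=> d Dd i; have [Xci _] := Xc i.
rewrite -(mem_conj_crown solG maxM) ?(subsetP sDM) //.
apply: (subsetP (sDs (M :^ (c i)^-1)%G _)) => //.
by apply: map_f; rewrite mem_enum.
Qed.

End Conjugates.

(** * The final family and its index bound *)

Theorem theorem7 (gT : finGroupType) (G : {group gT}) (gamma : nat)
    (H : {group gT}) :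
  solvable G ->
  (0 < gamma)%N ->
  maximal_intersection G H ->
  (forall V : irrModule G, in_VH V H -> gamma_module V gamma) ->
  k_intersection G gamma.+1 H.
Proof.
move=> solG _ [t0 [M0 [maxM0 defH]]] gammaV.
have sHG : H \subset G by rewrite defH subsetIl.
pose MM := [set M : {group gT} | maximal M G && (H \subset M)].
have maxMM : {in MM, forall M : {group gT}, maximal M G} by move=> M; rewrite inE => /andP[].
have sHMM : {in MM, forall M : {group gT}, H \subset M}.
  by move=> M; rewrite inE => /andP[].
have [S [sSMM indS spanS]] := independent_subfamily solG maxMM.
have sSM M SM := subsetP sSMM M SM.
(* Outside [S] the empty list is a dummy value that makes [s] a total function. *)
have extra M : exists s, M \in S -> detects G gamma H M s.
  have [/sSM MMM | _] := boolP (M \in S); last by exists [::].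
  have [s Ps] := gamma_conjugates solG (maxMM _ MMM) (sHMM _ MMM) gammaV.
  by exists s.
have [s Ps] := fin_all_exists extra.
pose L := flatten [seq M :: s M | M <- enum S].
have LP M : M \in L -> M \in MM.
  case/flattenP=> _ /mapP[k Sk ->]; rewrite mem_enum in Sk.
  rewrite inE => /predU1P[-> | sM]; first exact: sSM.
  by have [_ /(_ M sM)[maxM _ sHM] _] := Ps k Sk; rewrite inE maxM.
pose D : {group gT} := (G :&: \bigcap_(i < size L) tnth (in_tuple L) i)%G.
have DP M : M \in L -> D \subset M.
  move=> /(tnthP (in_tuple L))[i ->].
  by rewrite subIset // (bigcap_inf i) ?orbT.
have sDG : D \subset G by exact: subsetIl.
have LS M : M \in S -> M \in L.
  move=> SM; apply/flattenP; exists (M :: s M); rewrite ?mem_head //.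
  by apply: map_f; rewrite mem_enum.
have Ls M M' : M \in S -> M' \in s M -> M' \in L.
  move=> SM sM; apply/flattenP; exists (M :: s M); last by rewrite inE sM orbT.
  by apply: map_f; rewrite mem_enum.
(* The difference of orders turns descending induction on the crown into ordinary induction on
   [n]. *)
have sDMM n M : #|G| - #|crown G M| < n -> M \in MM -> D \subset M.
  elim: n M => // n IHn M leMn MMM; have maxM := maxMM M MMM.
  pose SX := [set k in S | crown G k == crown G M].
  have sSX : SX \subset S by apply/subsetP=> k; rewrite inE => /andP[].
  have eqX : {in SX, forall k, crown G k = crown G M}.
    by move=> k; rewrite inE => /andP[_ /eqP].
  have maxSX : {in SX, forall k : {group gT}, maximal k G}.
    by move=> k /(subsetP sSX)/sSM/maxMM.
  have spanSX : crown G M :&: \bigcap_(k in SX) gcore k G \subset gcore M G.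
    apply: subset_trans (spanS M MMM); apply: setIS; apply/bigcapsP=> k /andP[Sk eqk].
    by apply: (bigcap_inf k); rewrite inE Sk.
  have [k SXk [A [nA mulA mulAk capA]]] :=
    common_complement solG maxM maxSX eqX spanSX.
  have Sk := subsetP sSX k SXk.
  have mulT := interG_mul_crown solG (independentS sSX indS) eqX maxM.
  pose T := interG G SX.
  have sTG : T \subset G by exact: subsetIl.
  have tiT : T :&: crown G M \subset gcore M G.
    apply: subset_trans spanSX; rewrite subsetI subsetIr andTb.
    apply/bigcapsP=> k' SXk'; rewrite -(maximal_cap_crown solG (maxSX k' SXk')).
    rewrite (eqX k' SXk') setSI // subIset //; apply/orP; right.
    by apply: (bigcap_inf k').
  have sub_T (B : {group gT}) : B \subset G ->
      (forall k' : {group gT}, k' \in S -> B \subset k') ->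
      B \subset T.
    move=> sBG sBS; rewrite subsetI sBG; apply/bigcapsP=> k' /(subsetP sSX).
    exact: sBS.
  have [c Ac memM] := complement_cap_maximal solG maxM sTG mulT tiT nA mulA.
  (* The commutator lies in [A], where the cores of [M] and [k] have the same trace; so the vector
     [c] of the crown factor of [M] can be read in that of [k]. *)
  have memTk t : t \in T -> (t \in M) = ([~ t, c] \in gcore k G).
    move=> Tt; rewrite memM //.
    have Atc : [~ t, c] \in A.
      rewrite commgEr groupM ?memJ_norm ?groupV //.
      by rewrite (subsetP (normal_norm nA)) // (subsetP sTG).
    by have /setP/(_ [~ t, c]) := capA; rewrite !inE Atc.
  have sHT : H \subset T by apply: sub_T => // k' /sSM/sHMM.
  have sDT : D \subset T by apply: sub_T => // k' /LS/DP.
  have [_ _ clos] := Ps k Sk.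
  (* [H] lies in [T :&: M] and so fixes [c]; [clos] then shows that [D] fixes [c] as well. *)
  apply/subsetP=> d Dd; rewrite memTk ?(subsetP sDT) //.
  apply: (clos D) => //.
  - exact: DP (LS k Sk).
  - by move=> M' /(Ls k M' Sk)/DP.
  - move=> M' maxM' sXM' sHM'; apply: IHn; last by rewrite inE maxM'.
    (* A normal subgroup inside [M'] lies in its core, so the crown of [M'] is strictly larger than
       that of [k]. *)
    have sXY : crown G k \subset gcore M' G.
      by rewrite gcore_max // normal_norm ?crown_normal ?maxSX.
    have ltX : crown G k \proper crown G M'.
      rewrite properE (subset_trans sXY (sub_core_crown G M')) /=.
      apply: contra (crown_not_sub_core solG maxM') => /subset_trans; exact.
    have := proper_card ltX; rewrite (eqX k SXk).
    have := subset_leq_card (normal_sub (crown_normal solG maxM')).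
    move=> leG ltX'; apply: leq_trans _ (leMn : _ <= n).
    by rewrite ltn_sub2l // (leq_trans ltX').
  - by rewrite (eqX k SXk) -mulA (subsetP (mulG_subl _ _)).
  by move=> h Hh; rewrite -memTk ?(subsetP sHT) // (subsetP (sHMM M MMM)).
have defD : H :=: D.
  apply/eqP; rewrite eqEsubset; apply/andP; split.
    rewrite subsetI sHG; apply/bigcapsP=> i _; apply: sHMM; apply: LP.
    exact: mem_tnth.
  rewrite defH subsetI sDG; apply/bigcapsP=> i _; apply: (sDMM _ _ (ltnSn _)).
  by rewrite inE maxM0 defH subIset // (bigcap_inf i) ?orbT.
exists (size L), (tnth (in_tuple L)); split.
  by split=> // i; apply: maxMM; apply: LP; exact: mem_tnth.
have -> : (\prod_(i < size L) #|G : tnth (in_tuple L) i| =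
           \prod_(M in S) #|G : M| ^ (size (s M)).+1)%N.
  rewrite -(big_tnth _ _ L predT (fun M : {group gT} => #|G : M|)).
  rewrite big_flatten big_map big_enum /=; apply: eq_bigr => M SM.
  have [_ index_s _] := Ps M SM; rewrite big_cons expnS; congr (_ * _)%N.
  rewrite (eq_big_seq (fun=> #|G : M|)); last by move=> M' /index_s[].
  by rewrite big_const_seq count_predT iter_muln_1.
apply: (@leq_trans (\prod_(M in S) #|G : M| ^ gamma.+1)).
  apply: leq_prod => M SM; have [le_s _ _] := Ps M SM.
  by rewrite leq_pexp2l // indexg_gt0.
(* The indices over [S] multiply to [#|G : interG G S|], and [H] lies in [interG G S]. *)
rewrite -(big_morph (expn^~ gamma.+1) (fun x y => expnMn x y _) (exp1n _)).
rewrite (indexg_interG solG indS) leq_exp2r // dvdn_leq ?indexg_gt0 //.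
apply: indexgS; rewrite subsetI sHG; apply/bigcapsP=> M /sSM; exact: sHMM.
Qed.
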